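(* Let $d\ge1$, $\mathbf x_1,\dots,\mathbf x_n\in[0,1]^d$ and $\mathbf y=(y_1,\dots,y_n)\in\mathbb R^n$. Let $\mathbf A$ be the $n\times p$ design matrix and $\mathbf z_1=\mathbf 0,\mathbf z_2,\dots,\mathbf z_p\in[0,1]^d$ the associated points described in the context. Let $\hat{\boldsymbol\beta}=(\hat\beta_1,\dots,\hat\beta_p)$ be any solution of the nonnegative least squares problem $$\hat{\boldsymbol\beta}\in\operatorname*{arg\,min}_{\boldsymbol\beta\in\mathbb R^p:\ \beta_j\ge0\ \forall j\ge2}\|\mathbf y-\mathbf A\boldsymbol\beta\|^2 .$$ Then the function $$\hat f:=\sum_{j=1}^p\hat\beta_j\,\mathbb I_{[\mathbf z_j,\mathbf 1]}$$ is a solution of the optimization problem $$\operatorname*{arg\,min}_{f\in\mathcal F_{\mathrm{EM}}^d}\frac1n\sum_{i=1}^n(y_i-f(\mathbf x_i))^2 .$$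
   Context: Notation: $\mathbf 0=(0,\dots,0)$, $\mathbf 1=(1,\dots,1)$; $\mathbf a\preceq\mathbf b$ means $a_j\le b_j$ for all $j$; for $\mathbf a\preceq\mathbf b$, $[\mathbf a,\mathbf b]=\prod_j[a_j,b_j]$; $\mathbb I_A$ is the indicator function of $A$; $\|\cdot\|$ is the Euclidean norm. Quasi-volume: for $f:[0,1]^d\to\mathbb R$ and distinct $\mathbf a\preceq\mathbf b$ in $[0,1]^d$, $$\Delta(f;[\mathbf a,\mathbf b])=\sum_{j_1=0}^{J_1}\cdots\sum_{j_d=0}^{J_d}(-1)^{j_1+\dots+j_d}f(b_1+j_1(a_1-b_1),\dots,b_d+j_d(a_d-b_d)),$$ where $J_i=1$ if $a_i\ne b_i$ and $J_i=0$ otherwise. Entire monotonicity: $\mathcal F_{\mathrm{EM}}^d$ is the class of all $f:[0,1]^d\to\mathbb R$ with $\Delta(f;[\mathbf a,\mathbf b])\ge 0$ for all $\mathbf a\ne\mathbf b$ in $[0,1]^d$ with $\mathbf a\preceq\mathbf b$. Design matrix: for $\mathbf z\in[0,1]^d$ let $\mathbf v(\mathbf z)=(\mathbb I_{[\mathbf z,\mathbf 1]}(\mathbf x_1),\dots,\mathbb I_{[\mathbf z,\mathbf 1]}(\mathbf x_n))\in\{0,1\}^n$, and let $\mathcal Q=\{\mathbf v(\mathbf z):\mathbf z\in[0,1]^d\}$, a finite set, with $p=|\mathcal Q|$. $\mathbf A$ is the $n\times p$ matrix whose columns are the distinct elements of $\mathcal Q$, ordered so that the first column is $\mathbf v(\mathbf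 0)=(1,\dots,1)$. Distinct points $\mathbf z_1,\dots,\mathbf z_p\in[0,1]^d$ with $\mathbf z_1=\mathbf 0$ are fixed so that the $j$-th column of $\mathbf A$ is $\mathbf v(\mathbf z_j)$ for each $j$. *)

(* Defs.v *)
From HB Require Import structures.
From mathcomp Require Import all_boot all_order all_algebra.
From mathcomp Require Import all_classical all_reals all_analysis.

Set Implicit Arguments.
Unset Strict Implicit.
Unset Printing Implicit Defensive.

Import Order.TTheory GRing.Theory Num.Theory.
Local Open Scope classical_set_scope.
Local Open Scope ring_scope.

Section Defs.
Context {R : realType}.

Definition preceq {d : nat} (a b : 'rV[R]_d) : Prop :=
  forall j : 'I_d, a 0 j <= b 0 j.

Definition box {d : nat} (a b : 'rV[R]_d) : set 'rV[R]_d :=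
  [set x | preceq a x /\ preceq x b].

Definition ones {d : nat} : 'rV[R]_d := const_mx 1.

Definition cube (d : nat) : set 'rV[R]_d := box 0 ones.

(* The multi-index (j_1, ..., j_d) with 0 <= j_i <= J_i is encoded as a boolean
   function j such that j i is true only if a_i != b_i. *)
Definition quasi_volume {d : nat} (f : 'rV[R]_d -> R) (a b : 'rV[R]_d) : R :=
  \sum_(j : {ffun 'I_d -> bool} | [forall i, j i ==> (a 0 i != b 0 i)])
    (-1) ^+ (\sum_(i < d) j i)%N
      * f (\row_(i < d) (b 0 i + (j i)%:R * (a 0 i - b 0 i))).

(* A function [0,1]^d -> R is represented by a total function on R^d of which
   only the values on the cube are constrained: for a, b in the cube,
   quasi_volume f a b evaluates f only at points of the cube. *)
Definition entirely_monotone (d : nat) : set ('rV[R]_d -> R) :=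
  [set f | forall a b : 'rV[R]_d, cube a -> cube b -> a != b -> preceq a b ->
     0 <= quasi_volume f a b].

(* The norm that the library puts on matrices is the sup norm. *)
Definition euclidean_norm {n : nat} (u : 'cV[R]_n) : R :=
  Num.sqrt (\sum_(i < n) u i 0 ^+ 2).

Definition argmin {T : Type} (S : set T) (g : T -> R) : set T :=
  [set t | S t /\ forall s, S s -> g t <= g s].

Section Design.
Context {d n : nat} (x : 'I_n -> 'rV[R]_d).

Definition design_vector (z : 'rV[R]_d) : 'cV[R]_n :=
  \col_(i < n) \1_(box z ones) (x i).

Definition design_vectors : set 'cV[R]_n := design_vector @` @cube d.

(* The number |Q| of columns is at least 1, since Q contains v(0); it is written
   p.+1 so that ord0 is the index of the first column.  The bijection says that
   the columns of A are pairwise distinct and are exactly the elements of Q. *)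
Definition is_design {p : nat} (A : 'M[R]_(n, p.+1))
    (z : 'I_p.+1 -> 'rV[R]_d) : Prop :=
  [/\ set_bij [set: 'I_p.+1] design_vectors (fun j => col j A),
      injective z,
      (forall j, cube (z j)),
      z ord0 = 0
    & forall j, col j A = design_vector (z j)].

End Design.

Definition nnls_objective {n q : nat} (A : 'M[R]_(n, q)) (y : 'cV[R]_n)
    (beta : 'cV[R]_q) : R :=
  euclidean_norm (y - A *m beta) ^+ 2.

Definition nnls_feasible (p : nat) : set 'cV[R]_p.+1 :=
  [set beta | forall j : 'I_p.+1, j != ord0 -> 0 <= beta j 0].

Definition empirical_risk {d n : nat} (x : 'I_n -> 'rV[R]_d) (y : 'cV[R]_n)
    (f : 'rV[R]_d -> R) : R :=
  n%:R^-1 * \sum_(i < n) (y i 0 - f (x i)) ^+ 2.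

Definition fitted_function {d p : nat} (z : 'I_p.+1 -> 'rV[R]_d)
    (beta : 'cV[R]_p.+1) : 'rV[R]_d -> R :=
  fun u => \sum_(j < p.+1) beta j 0 * \1_(box (z j) ones) u.

End Defs.

(* Main.v *)
(* On the finite grid spanned by 0 and the coordinates of the design points, an
   entirely monotone f is, by Moebius inversion, the combination of the indicators
   of the boxes [g, 1], g a grid point, whose coefficients are the quasi-volumes of
   f on the cells [g^-, g] with g^- the predecessor of g in each coordinate.  These
   coefficients are nonnegative except possibly at g = 0.  Grouping the grid points
   according to the column v(g) of A shows that the values of f on the design are
   A beta for a feasible beta.  Conversely, the quasi-volume of the indicator of
   [z, 1] is a product of nonnegative factors, one of which vanishes when z = 0, so
   the fitted function of a feasible beta is entirely monotone.  Hence the two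
   problems minimize over the same vectors of fitted values. *)
Require Import Defs.
From HB Require Import structures.
From mathcomp Require Import all_boot all_order all_algebra.
From mathcomp Require Import all_classical all_reals all_analysis.

Set Implicit Arguments.
Unset Strict Implicit.
Unset Printing Implicit Defensive.

Import Order.TTheory GRing.Theory Num.Theory.
Local Open Scope classical_set_scope.
Local Open Scope ring_scope.

(** * Möbius inversion on a finite product of chains *)

Section GridDifferences.
Context {R : comNzRingType} {d m : nat}.
Implicit Types k l K : {ffun 'I_d -> 'I_m.+1}.

(** Truncated subtraction keeps a zero coordinate at zero. *)
Definition grid_decr k (j : {ffun 'I_d -> bool}) : {ffun 'I_d -> 'I_m.+1} :=
  [ffun i => inord (k i - j i)].

(** Mixed backward difference; the guard amounts to extending [F] by zero below index 0. *)
Definition grid_difference (F : {ffun 'I_d -> 'I_m.+1} -> R) k : R :=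
  \sum_(j : {ffun 'I_d -> bool} | [forall i, j i ==> (k i != ord0)])
    (-1) ^+ (\sum_(i < d) j i)%N * F (grid_decr k j).

Lemma sum_ord_difference_kernel (l K : 'I_m.+1) :
  \sum_(a : 'I_m.+1 | (a <= K)%N) \sum_(b : bool | b ==> (a != ord0))
    (-1) ^+ b * (l == inord (a - b))%:R = (l == K)%:R :> R.
Proof.
(* Stating [l = a - 1] as [l.+1 == a] absorbs the guard, since it fails at [a = 0]. The sum then
   telescopes. *)
transitivity (\sum_(a < m.+1 | (a < K.+1)%N)
    (((l : nat) == a)%:R - (l.+1 == a)%:R : R)).
  apply: eq_bigr => a _; rewrite big_mkcond big_bool /= mulN1r mul1r subn0.
  rewrite inord_val addrC; congr (_ + _).
  case: a => [[|a] ha]; first by rewrite -val_eqE /= oppr0.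
  by rewrite -!val_eqE /= subn1 /= eqSS inordK // ltnW.
rewrite -(big_ord_widen _ (fun a => ((l : nat) == a)%:R - (l.+1 == a)%:R)) //.
rewrite -(big_mkord predT (fun a => ((l : nat) == a)%:R - (l.+1 == a)%:R)).
rewrite -(val_eqE l K) /=.
elim: (K : nat) => [|k IH]; first by rewrite big_nat1 subr0.
by rewrite big_nat_recr //= IH eqSS addrCA subrr addr0.
Qed.

(* The sum over k and j factors over the coordinates, and each factor is the
   telescoping sum of [sum_ord_difference_kernel]. *)
Lemma sum_grid_difference (F : {ffun 'I_d -> 'I_m.+1} -> R) K :
  \sum_(k : {ffun 'I_d -> 'I_m.+1} | [forall i, (k i <= K i)%N])
    grid_difference F k = F K.
Proof.
pose c (l k : 'I_m.+1) (b : bool) : R := (-1) ^+ b * (l == inord (k - b))%:R.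
(* A Kronecker delta picks out [l = grid_decr k j], which separates the kernel from [F]. *)
have diffE k : grid_difference F k = \sum_(l : {ffun 'I_d -> 'I_m.+1})
    (\prod_i \sum_(b : bool | b ==> (k i != ord0)) c (l i) (k i) b) * F l.
  under [RHS]eq_bigr => l _ do rewrite bigA_distr_big_dep mulr_suml.
  rewrite exchange_big /=; apply: eq_big => [j|j _].
    by apply/forallP/familyP => h i; have := h i.
  rewrite (bigD1 (grid_decr k j)) //= [X in _ + X]big1 ?addr0.
    congr (_ * _); rewrite -prodrXr; apply: eq_bigr => i _.
    by rewrite /c ffunE eqxx mulr1.
  move=> l /eqP hl; have [i hi] : exists i, l i != inord (k i - j i).
    apply/existsP; rewrite -negb_forall; apply: contra_notN hl => /forallP h.
    by apply/ffunP => i; rewrite ffunE; apply/eqP.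
  by rewrite (bigD1 i) //= /c (negbTE hi) mulr0 !mul0r.
under eq_bigr => k _ do rewrite diffE.
have kernelE l : \sum_(k : {ffun 'I_d -> 'I_m.+1} | [forall i, (k i <= K i)%N])
    \prod_i \sum_(b : bool | b ==> (k i != ord0)) c (l i) (k i) b =
    \prod_(i < d) ((l i == K i)%:R : R).
  under [RHS]eq_bigr => i _ do rewrite -sum_ord_difference_kernel.
  rewrite bigA_distr_big_dep; apply: eq_bigl => k.
  by apply/forallP/familyP => h i; have := h i.
rewrite exchange_big /= (bigD1 K) //= [X in _ + X]big1 ?addr0 => [|l hl];
  rewrite -mulr_suml kernelE.
  by rewrite big1 ?mul1r // => i _; rewrite eqxx.
have [i hi] : exists i, l i != K i.
  apply/existsP; rewrite -negb_forall; apply: contra hl => /forallP h.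
  by apply/eqP/ffunP => i; apply/eqP.
by rewrite (bigD1 i) //= (negbTE hi) !mul0r.
Qed.

End GridDifferences.

(** * Quasi-volumes of box indicators *)

Section EntireMonotonicity.
Context {R : realType} {d : nat}.
Implicit Types (a b u v z : 'rV[R]_d).

Lemma preceq_prodE u v :
  \prod_(i < d) (u 0 i <= v 0 i)%R%:R = (`[< preceq u v >])%:R :> R.
Proof.
case: asboolP => [h|/existsNP[i /negP hi]]; first by rewrite big1 // => i _; rewrite h.
by rewrite (bigD1 i) //= (negbTE hi) mul0r.
Qed.

Lemma indic_box_ones z u : preceq u ones ->
  \1_(box z ones) u = \prod_(i < d) (z 0 i <= u 0 i)%R%:R :> R.
Proof.
move=> hu; rewrite indicE preceq_prodE; congr (_%:R); congr nat_of_bool.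
by apply/idP/asboolP => [|h]; rewrite inE //= => -[].
Qed.

Lemma quasi_volume_sum (I : finType) (c : I -> R) (g : I -> 'rV[R]_d -> R) a b :
  quasi_volume (fun u => \sum_i c i * g i u) a b =
  \sum_i c i * quasi_volume (g i) a b.
Proof.
rewrite /quasi_volume; under eq_bigr => j _ do rewrite mulr_sumr.
rewrite exchange_big; apply: eq_bigr => i _; rewrite mulr_sumr.
by apply: eq_bigr => j _; rewrite mulrCA.
Qed.

(** On the cube the indicator is a product over coordinates, so the alternating sum over vertices
    factors into one-dimensional differences. *)
Lemma quasi_volume_box z a b : cube a -> cube b ->
  quasi_volume \1_(box z ones) a b =
  \prod_(i < d) ((z 0 i <= b 0 i)%R%:R
                 - (a 0 i != b 0 i)%R%:R * (z 0 i <= a 0 i)%R%:R).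
Proof.
move=> [_ ha] [_ hb].
transitivity (\prod_(i < d) \sum_(e : bool | e ==> (a 0 i != b 0 i))
   ((-1) ^+ e * (z 0 i <= b 0 i + e%:R * (a 0 i - b 0 i))%R%:R : R)).
  rewrite bigA_distr_big_dep; apply: eq_big => [j|j _].
    by apply/forallP/familyP => h i; have := h i.
  rewrite indic_box_ones => [|i].
    rewrite big_split /= prodrXr; congr (_ * _).
    by apply: eq_bigr => i _; rewrite mxE.
  have := ha i; have := hb i; rewrite !mxE.
  by case: (j i); rewrite ?mul0r ?addr0 // mul1r addrC subrK.
apply: eq_bigr => i _; rewrite big_mkcond big_bool /= mul0r addr0 !mul1r.
rewrite [b 0 i + _]addrC subrK mulN1r addrC; congr (_ + _).
by case: (a 0 i != b 0 i); rewrite ?mul1r ?mul0r ?oppr0.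
Qed.

Lemma quasi_volume_box_ge0 z a b : cube a -> cube b -> preceq a b ->
  0 <= quasi_volume (\1_(box z ones) : _ -> R) a b.
Proof.
move=> ha hb hab; rewrite quasi_volume_box //; apply: prodr_ge0 => i _.
case: (z 0 i <= a 0 i) / boolP => hz; last by rewrite mulr0 subr0 ler0n.
by rewrite (le_trans hz (hab i)) mulr1 subr_ge0; case: (_ != _); rewrite ?ler01.
Qed.

(** A coordinate where [a] and [b] differ contributes the factor [1 - 1]. Hence the first
    coefficient may have any sign. *)
Lemma quasi_volume_box0 a b : cube a -> cube b -> a != b ->
  quasi_volume (\1_(box 0 ones) : _ -> R) a b = 0.
Proof.
move=> ha hb hab; rewrite quasi_volume_box //.
have [i hi] : exists i, a 0 i != b 0 i.
  apply/existsP; rewrite -negb_forall; apply: contra hab => /forallP h.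
  by apply/eqP/rowP => i; apply/eqP.
by rewrite (bigD1 i) //= ha.1 hb.1 hi mulr1 subrr mul0r.
Qed.

Lemma fitted_function_entirely_monotone {p : nat} (z : 'I_p.+1 -> 'rV[R]_d)
    (beta : 'cV[R]_p.+1) :
  z ord0 = 0 -> nnls_feasible beta -> entirely_monotone (fitted_function z beta).
Proof.
move=> z0 hbeta a b ha hb hab leab.
rewrite quasi_volume_sum; apply: sumr_ge0 => j _.
have [->|hj] := eqVneq j ord0; first by rewrite z0 quasi_volume_box0 ?mulr0.
by rewrite mulr_ge0 ?quasi_volume_box_ge0 ?hbeta.
Qed.

End EntireMonotonicity.

(** * Entirely monotone functions on a grid with levels [0 = t 0 < ... < t m <= 1] *)

Section GridRepresentation.
Context {R : realType} {d m : nat} (t : nat -> R).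
Hypotheses (t0 : t 0%N = 0)
  (t_mono : {in gtn m.+1 &, {mono t : i j / (i <= j)%N >-> i <= j}})
  (t_le1 : forall i, (i < m.+1)%N -> t i <= 1).
Implicit Types k K : {ffun 'I_d -> 'I_m.+1}.

Definition grid_point k : 'rV[R]_d := \row_i t (k i).

Lemma grid_point_preceq k K :
  reflect (preceq (grid_point k) (grid_point K)) [forall i, (k i <= K i)%N].
Proof.
apply: (iffP forallP) => h i; have := h i; rewrite !mxE t_mono //= inE;
  exact: ltn_ord.
Qed.

Lemma cube_grid_point k : cube (grid_point k).
Proof.
split=> i; rewrite !mxE; last exact: t_le1.
by rewrite -t0 t_mono // inE.
Qed.

Lemma grid_difference_ge0 (f : 'rV[R]_d -> R) k :
  entirely_monotone f -> grid_point k != 0 ->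
  0 <= grid_difference (f \o grid_point) k.
Proof.
move=> hf hk.
have tinj (i j : 'I_m.+1) : (t i == t j) = (i == j).
  by rewrite eq_le !t_mono ?inE // -eqn_leq.
(* The lower corner of the cell. By truncation it agrees with [k] exactly where [k i = 0], so the
   guards of [grid_difference] and [quasi_volume] coincide. *)
pose k' := grid_decr k [ffun=> true].
have k'E i : k' i = (k i).-1 :> nat.
  by rewrite !ffunE subn1 inordK // (leq_ltn_trans (leq_pred _)).
have neqE i : (grid_point k' 0 i != grid_point k 0 i) = (k i != ord0).
  rewrite !mxE tinj -!val_eqE /= k'E.
  by case: (k i : nat) => //= q; rewrite ltn_eqF.
suff -> : grid_difference (f \o grid_point) k
          = quasi_volume f (grid_point k') (grid_point k).
  apply: hf; try exact: cube_grid_point.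
    apply: contra hk => /eqP/rowP h; apply/eqP/rowP => i.
    move/eqP: (h i); rewrite -[_ == _]negbK neqE negbK => /eqP hi.
    by rewrite !mxE hi t0.
  by apply/grid_point_preceq/forallP => i; rewrite k'E leq_pred.
apply: eq_big => [j|j /forallP hj].
  by apply: eq_forallb => i; rewrite neqE.
congr (_ * f _); apply/rowP => i; rewrite !mxE k'E ffunE.
case: (j i); rewrite ?mul0r ?addr0 ?subn0 ?inord_val // mul1r addrC subrK.
by rewrite subn1 inordK // (leq_ltn_trans (leq_pred _)).
Qed.

(** The indicator encodes the range [k <= K] of the inversion formula. *)
Lemma grid_difference_sum (f : 'rV[R]_d -> R) K :
  f (grid_point K) = \sum_(k : {ffun 'I_d -> 'I_m.+1})
    grid_difference (f \o grid_point) k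
      * \1_(box (grid_point k) ones) (grid_point K).
Proof.
rewrite -[LHS](sum_grid_difference (f \o grid_point) K) big_mkcond /=.
apply: eq_bigr => k _; rewrite indicE; case: grid_point_preceq => h.
  by rewrite mem_set ?mulr1 //; split => //; case: (cube_grid_point K).
by rewrite memNset ?mulr0 // => -[].
Qed.

End GridRepresentation.

(** * Fitted values on the design *)

Section Design.
Context {R : realType} {d n p : nat} (x : 'I_n -> 'rV[R]_d).
Hypothesis hx : forall i, cube (x i).

Lemma design_grid : exists (m : nat) (t : nat -> R),
  [/\ t 0%N = 0,
      {in gtn m.+1 &, {mono t : i j / (i <= j)%N >-> i <= j}},
      (forall i, (i < m.+1)%N -> t i <= 1)
    & forall i, exists K : {ffun 'I_d -> 'I_m.+1}, x i = grid_point t K].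
Proof.
(* One list of levels serves all coordinates. Adding 0, the least level, gives [t 0 = 0]. *)
pose r : seq R := 0 :: [seq x i.1 0 i.2 | i : 'I_n * 'I_d].
pose s := sort <=%R (undup r).
have mem_s a : (a \in s) = (a \in r) by rewrite mem_sort mem_undup.
have s_lt : sorted <%R s by rewrite sort_lt_sorted undup_uniq.
have s_in a : a \in s -> 0 <= a <= 1.
  rewrite mem_s inE => /orP[/eqP->|/mapP[[i c] _ ->]]; first by rewrite lexx ler01.
  have [/(_ c) h0 /(_ c) h1] := hx i.
  by move: h0 h1; rewrite !mxE => -> ->.
have s0 : 0 \in s by rewrite mem_s mem_head.
have s_gt0 : (0 < size s)%N by case: (s) s0.
have sE : (size s).-1.+1 = size s by rewrite prednK.
have nth_mono : {in gtn (size s) &, {mono nth 0 s : i j / (i <= j)%N >-> i <= j}}.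
  by move=> i j hi hj; rewrite (lt_sorted_leq_nth 0 s_lt).
exists (size s).-1, (nth 0 s); split; rewrite ?sE //.
- apply/eqP; rewrite eq_le; apply/andP; split; last first.
    by case/andP: (s_in _ (mem_nth 0 s_gt0)).
  by rewrite -{2}(nth_index 0 s0) nth_mono ?inE // index_mem.
- by move=> i hi; case/andP: (s_in _ (mem_nth 0 hi)).
move=> i; exists [ffun c => inord (index (x i 0 c) s)]; apply/rowP => c.
have hc : x i 0 c \in s.
  by rewrite mem_s inE; apply/orP; right; apply/mapP; exists (i, c); rewrite ?mem_enum.
by rewrite mxE ffunE inordK ?sE ?index_mem // nth_index.
Qed.

Lemma entirely_monotone_design (A : 'M[R]_(n, p.+1)) (z : 'I_p.+1 -> 'rV[R]_d)
    (f : 'rV[R]_d -> R) :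
  is_design x A z -> entirely_monotone f ->
  exists2 beta : 'cV[R]_p.+1, nnls_feasible beta
    & forall i, (A *m beta) i 0 = f (x i).
Proof.
move=> [[_ A_inj A_surj] _ _ z0 Az] hf.
have [m [t [t0 t_mono t_le1 xE]]] := design_grid.
have /choice[J hJ] : forall k : {ffun 'I_d -> 'I_m.+1},
    exists j, col j A = design_vector x (grid_point t k).
  move=> k; have [|j _ hj] := A_surj (design_vector x (grid_point t k)).
    by exists (grid_point t k) => //; exact: cube_grid_point.
  by exists j.
pose D (k : {ffun 'I_d -> 'I_m.+1}) := grid_difference (f \o grid_point t) k.
(* Grid points with the same column pool their coefficients. *)
exists (\col_j \sum_(k | J k == j) D k) => [j hj|i].
  rewrite mxE; apply: sumr_ge0 => k /eqP hk.
  (* Columns are distinct, so the origin can only be sent to the first one. *)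
  apply: grid_difference_ge0 => //; apply: contra hj => /eqP k0.
  by rewrite -hk; apply/eqP/A_inj; rewrite ?inE // hJ Az z0 k0.
have [K xK] := xE i.
rewrite mxE xK (grid_difference_sum t0 t_mono t_le1) (partition_big J predT) //=.
apply: eq_bigr => j _; rewrite mxE mulr_sumr; apply: eq_bigr => k /eqP hk.
rewrite mulrC -hk; congr (_ * _).
by move/colP/(_ i): (hJ k); rewrite !mxE xK.
Qed.

Lemma empirical_risk_nnls (A : 'M[R]_(n, p.+1)) (y : 'cV[R]_n)
    (f : 'rV[R]_d -> R) (beta : 'cV[R]_p.+1) :
  (forall i, (A *m beta) i 0 = f (x i)) ->
  empirical_risk x y f = n%:R^-1 * nnls_objective A y beta.
Proof.
move=> hf; rewrite /nnls_objective sqr_sqrtr ?sumr_ge0 // => [|i _]; last exact: sqr_ge0.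
by congr (_ * _); apply: eq_bigr => i _; rewrite -hf !mxE.
Qed.

Lemma mul_design (A : 'M[R]_(n, p.+1)) (z : 'I_p.+1 -> 'rV[R]_d)
    (beta : 'cV[R]_p.+1) (i : 'I_n) :
  is_design x A z -> (A *m beta) i 0 = fitted_function z beta (x i).
Proof.
move=> [_ _ _ _ Az]; rewrite mxE; apply: eq_bigr => j _.
by move/colP/(_ i): (Az j); rewrite !mxE mulrC => ->.
Qed.

End Design.

Theorem proposition3p1 (R : realType) (d n p : nat)
    (hd : (1 <= d)%N) (hn : (1 <= n)%N)
    (x : 'I_n -> 'rV[R]_d) (hx : forall i, cube (x i))
    (y : 'cV[R]_n)
    (A : 'M[R]_(n, p.+1)) (z : 'I_p.+1 -> 'rV[R]_d)
    (hAz : is_design x A z)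
    (beta : 'cV[R]_p.+1)
    (hbeta : argmin (@nnls_feasible R p) (nnls_objective A y) beta) :
  argmin (@entirely_monotone R d) (empirical_risk x y) (fitted_function z beta).
Proof.
have [beta_feas beta_min] := hbeta; have [_ _ _ z0 _] := hAz.
split=> [|f hf]; first exact: fitted_function_entirely_monotone.
(* The competitor [f] has the fitted values of the feasible [gamma], against which [beta] is
   optimal. *)
have [gamma gamma_feas hgamma] := entirely_monotone_design hx hAz hf.
rewrite (empirical_risk_nnls y hgamma).
rewrite (empirical_risk_nnls y (fun i => mul_design beta i hAz)).
by rewrite ler_wpM2l ?invr_ge0 ?ler0n ?beta_min.
Qed.
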